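(* Let $K$ be a field of characteristic zero, let $F_3$ be the free algebra of rank $3$ with free generators $x_1,x_2,x_3$ in the variety $\mathcal{G}$ of unitary associative $K$-algebras satisfying $[[z_1,z_2],z_3]=0$, and let $F_3'$ be its commutator ideal. Put \[ f_{0,1,0}=(x_2-x_1)[x_2,x_1]+(x_3-x_1)[x_3,x_1]+(x_3-x_2)[x_3,x_2], \] \[ f_{0,2,0}=(x_2^2-x_1^2)[x_2,x_1]+(x_3^2-x_1^2)[x_3,x_1]+(x_3^2-x_2^2)[x_3,x_2], \] \[ f_{1,2,0}=(x_1x_2^2-x_1^2x_2)[x_2,x_1]+(x_1x_3^2-x_1^2x_3)[x_3,x_1]+(x_2x_3^2-x_2^2x_3)[x_3,x_2]. \] Then the set $\{f_{0,1,0},f_{0,2,0},f_{1,2,0}\}$ is a minimal generating set for the left $K[X_3]^{S_3}$-module $(F_3')^{S_3}$ of symmetric polynomials in $F_3'$ (that is, it generates the module and no proper subset of it does). Moreover, $(F_3')^{S_3}$ is freely generated by $f_{0,1,0}$, $f_{0,2,0}$ and $f_{1,2,0}$ as a left $K[X_3]^{S_3}$-module.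
   Context: $[u,v]=uv-vu$. $\mathcal{G}$ is the variety of all unitary associative $K$-algebras satisfying the polynomial identity $[[z_1,z_2],z_3]=0$ (the variety generated by the infinite dimensional Grassmann algebra). The free algebra $F_3$ is the quotient of the free unitary associative algebra $K\langle x_1,x_2,x_3\rangle$ by the two-sided ideal generated by all elements $[[u,v],w]$, $u,v,w\in K\langle x_1,x_2,x_3\rangle$; the images of the generators are again denoted $x_1,x_2,x_3$. The commutator ideal is $F_3'=F_3[F_3,F_3]F_3$, the two-sided ideal generated by all commutators. $K[X_3]$ is the commutative polynomial algebra in $x_1,x_2,x_3$. For every $w\in F_3'$ and all $i,j$ one has $x_ix_jw=x_jx_iw$ in $F_3$, so left multiplication makes $F_3'$ a left $K[X_3]$-module (each variable $x_i$ acts by left multiplication by $x_i$). The symmetric group $S_3$ acts on $F_3$ (and on $K[X_3]$) by algebra automorphisms $\xi\cdot s(x_1,x_2,x_3)=s(x_{\xi 1},x_{\xi 2},x_{\xi 3})$; an element is called symmetric if it is fixed by all $\xi\in S_3$. $K[X_3]^{S_3}$ is the algebra of symmetric polynomials in $K[X_3]$ and $(F_3')^{S_3}$ is the set of symmetric elements of $F_3'$, which is a left $K[X_3]^{S_3}$-module. *)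

(* Defs.v *)
From HB Require Import structures.
From mathcomp Require Import all_boot all_order all_fingroup all_algebra.
From mathcomp Require Import generic_quotient ring_quotient.
From mathcomp Require Import boolp.
From mathcomp Require Import monalg.
From mathcomp Require Import mpoly.

Set Implicit Arguments.
Unset Strict Implicit.
Unset Printing Implicit Defensive.

Import GRing.Theory.

Local Open Scope ring_scope.
Local Open Scope quotient_scope.

(* monalg declares the same notation in type_scope for another type. *)
Local Notation "{ 'mpoly' T [ n ] }" := (mpoly.mpoly n T) : type_scope.

Section TwoSidedIdeal.

Variable R : nzRingType.

Definition lie (u v : R) : R := u * v - v * u.

Definition two_sided_ideal (S : R -> Prop) : {pred R} := fun x =>
  `[< exists r : seq (R * R * R),
        (forall t, t \in r -> S t.1.2) /\
        x = \sum_(t <- r) t.1.1 * t.1.2 * t.2 >].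

Definition is_commutator (z : R) : Prop := exists u v, z = lie u v.

Definition is_double_commutator (z : R) : Prop :=
  exists u v w, z = lie (lie u v) w.

Variable S : R -> Prop.
Local Notation I := (two_sided_ideal S).

Lemma mem_ideal x : S x -> x \in I.
Proof.
move=> Sx; apply/asboolP; exists [:: (1, x, 1)]; split.
  by move=> t; rewrite inE => /eqP ->.
by rewrite big_seq1 mul1r mulr1.
Qed.

Lemma idealMl a x : x \in I -> a * x \in I.
Proof.
move=> /asboolP [r [Sr ->]]; apply/asboolP.
exists [seq (a * t.1.1, t.1.2, t.2) | t <- r]; split.
  by move=> _ /mapP[t tr ->]; exact: (Sr t tr).
by rewrite big_map mulr_sumr; apply: eq_bigr => t _; rewrite !mulrA.
Qed.

Lemma idealMrr a x : x \in I -> x * a \in I.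
Proof.
move=> /asboolP [r [Sr ->]]; apply/asboolP.
exists [seq (t.1.1, t.1.2, t.2 * a) | t <- r]; split.
  by move=> _ /mapP[t tr ->]; exact: (Sr t tr).
by rewrite big_map mulr_suml; apply: eq_bigr => t _; rewrite !mulrA.
Qed.

Lemma ideal_zmod_closed : zmod_closed I.
Proof.
split; first by apply/asboolP; exists [::]; rewrite big_nil.
move=> x y xI yI; move: xI (idealMl (-1) yI) => /asboolP[r [Sr ->]].
rewrite mulN1r => /asboolP[r' [Sr' ->]]; apply/asboolP; exists (r ++ r').
split; last by rewrite big_cat.
by move=> t; rewrite mem_cat => /orP[/Sr|/Sr'].
Qed.

HB.instance Definition _ :=
  GRing.isZmodClosed.Build R (two_sided_ideal S) ideal_zmod_closed.

Lemma ideal_ind (P : R -> Prop) : P 0 -> (forall x y, P x -> P y -> P (x + y)) ->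
  (forall a s b, S s -> P (a * s * b)) -> forall x, x \in I -> P x.
Proof.
move=> P0 PD PS x /asboolP[r [Sr ->]]; rewrite big_seq.
by elim/big_ind: _ => // t /Sr; apply: PS.
Qed.

End TwoSidedIdeal.

Lemma rmorph_lie (R R' : nzRingType) (f : {rmorphism R -> R'}) (u v : R) :
  f (lie u v) = lie (f u) (f v).
Proof. by rewrite /lie rmorphB !rmorphM. Qed.

Lemma one_notin_double_commutator_ideal (R : nzRingType) (C : comNzRingType)
  (f : {rmorphism R -> C}) : 1 \notin two_sided_ideal (@is_double_commutator R).
Proof.
apply/negP => h; suff: f 1 = 0 by move/eqP; rewrite rmorph1 oner_eq0.
elim/ideal_ind: h => [|x y x0 y0|a _ b [u [v [w ->]]]].
- exact: raddf0.
- by rewrite raddfD /= x0 y0 addr0.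
by rewrite !rmorphM /= rmorph_lie /lie [X in _ * (X - _) * _]mulrC
  subrr mulr0 mul0r.
Qed.

Section QuotientAlgebra.

Variables (K : fieldType) (A : algType K) (S : A -> Prop).
Hypothesis proper : 1 \notin two_sided_ideal S.

Local Notation I := (two_sided_ideal S).

(* ring_quotient only provides the ring structure for commutative rings. *)
Definition quotAlg of 1 \notin I : Type := Quotient.quot I.
Local Notation Q := (quotAlg proper).

HB.instance Definition _ := EqQuotient.on Q.
HB.instance Definition _ := Choice.on Q.
HB.instance Definition _ := ZmodQuotient.on Q.

Lemma pi_quotP (a b : A) : reflect (a = b %[mod Q]) (a - b \in I).
Proof. by rewrite (@Quotient.idealrBE _ I a b); apply: eqP. Qed.

Definition quot_one : Q := lift_cst Q 1.
Definition quot_mul := lift_op2 Q *%R.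
Definition quot_scale (c : K) := lift_op1 Q ( *:%R c).

Canonical pi_quot_one_morph := PiConst quot_one.

Fact pi_quot_mul : {morph \pi_Q : x y / x * y >-> quot_mul x y}.
Proof.
move=> x y; unlock quot_mul; apply/pi_quotP.
rewrite -[x * y](addrNK (x * repr (\pi_Q y))) -mulrBr -addrA -mulrBl.
apply: rpredD; [apply: idealMl|apply: idealMrr];
  by apply/pi_quotP; rewrite reprK.
Qed.
Canonical pi_quot_mul_morph := PiMorph2 pi_quot_mul.

Fact pi_quot_scale c : {morph \pi_Q : x / c *: x >-> quot_scale c x}.
Proof.
move=> x; unlock quot_scale; apply/pi_quotP; rewrite -scalerBr.
rewrite -[_ - _]mul1r scalerAl; apply: idealMl.
by apply/pi_quotP; rewrite reprK.
Qed.
Canonical pi_quot_scale_morph c := PiMorph1 (pi_quot_scale c).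

Fact quot_mulA : associative quot_mul.
Proof.
by move=> x y z; rewrite -[x]reprK -[y]reprK -[z]reprK !piE mulrA.
Qed.

Fact quot_mul1 : left_id quot_one quot_mul.
Proof. by move=> x; rewrite -[x]reprK !piE mul1r. Qed.

Fact quot_mulr1 : right_id quot_one quot_mul.
Proof. by move=> x; rewrite -[x]reprK !piE mulr1. Qed.

Fact quot_mulDl : left_distributive quot_mul +%R.
Proof.
by move=> x y z; rewrite -[x]reprK -[y]reprK -[z]reprK !piE mulrDl.
Qed.

Fact quot_mulDr : right_distributive quot_mul +%R.
Proof.
by move=> x y z; rewrite -[x]reprK -[y]reprK -[z]reprK !piE mulrDr.
Qed.

Fact quot_one_neq0 : quot_one != 0.
Proof.
by apply/eqP; rewrite !piE => /pi_quotP; rewrite subr0 (negPf proper).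
Qed.

HB.instance Definition _ := GRing.Zmodule_isNzRing.Build Q
  quot_mulA quot_mul1 quot_mulr1 quot_mulDl quot_mulDr quot_one_neq0.

Fact quot_scaleA a b x : quot_scale a (quot_scale b x) = quot_scale (a * b) x.
Proof. by rewrite -[x]reprK !piE scalerA. Qed.

Fact quot_scale1 : left_id 1 quot_scale.
Proof. by move=> x; rewrite -[x]reprK !piE scale1r. Qed.

Fact quot_scaleDr : right_distributive quot_scale +%R.
Proof. by move=> a x y; rewrite -[x]reprK -[y]reprK !piE scalerDr. Qed.

Fact quot_scaleDl x : {morph quot_scale^~ x : a b / a + b}.
Proof. by move=> a b; rewrite -[x]reprK !piE scalerDl. Qed.

HB.instance Definition _ := GRing.Zmodule_isLmodule.Build K Q
  quot_scaleA quot_scale1 quot_scaleDr quot_scaleDl.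

Lemma pi_quot0 : \pi_Q (0 : A) = 0.
Proof. exact: (raddf0 \pi_Q). Qed.

Lemma pi_quotD (a b : A) : \pi_Q (a + b) = \pi_Q a + \pi_Q b.
Proof. exact: (raddfD \pi_Q). Qed.

Lemma pi_quotB (a b : A) : \pi_Q (a - b) = \pi_Q a - \pi_Q b.
Proof. exact: (raddfB \pi_Q). Qed.

Lemma pi_quot1 : \pi_Q (1 : A) = 1.
Proof. by rewrite -[RHS]/quot_one piE. Qed.

Lemma pi_quotM (a b : A) : \pi_Q (a * b) = \pi_Q a * \pi_Q b.
Proof. by rewrite pi_quot_mul. Qed.

Lemma pi_quotZ c (a : A) : \pi_Q (c *: a) = c *: \pi_Q a.
Proof. by rewrite pi_quot_scale. Qed.

Fact quot_scaleAl (c : K) (x y : Q) : c *: (x * y) = (c *: x) * y.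
Proof.
by rewrite -[x]reprK -[y]reprK -!(pi_quotM, pi_quotZ) scalerAl.
Qed.
HB.instance Definition _ := GRing.Lmodule_isLalgebra.Build K Q quot_scaleAl.

Fact quot_scaleAr (c : K) (x y : Q) : c *: (x * y) = x * (c *: y).
Proof.
by rewrite -[x]reprK -[y]reprK -!(pi_quotM, pi_quotZ) scalerAr.
Qed.
HB.instance Definition _ := GRing.Lalgebra_isAlgebra.Build K Q quot_scaleAr.

Lemma pi_quot_ideal a : S a -> \pi_Q a = 0.
Proof.
by move=> Sa; rewrite -pi_quot0; apply/pi_quotP; rewrite subr0 mem_ideal.
Qed.

Lemma quot_identity : (forall a b c, S (lie (lie a b) c)) ->
  forall u v w : Q, lie (lie u v) w = 0.
Proof.
move=> SL u v w; rewrite -[u]reprK -[v]reprK -[w]reprK.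
rewrite -(pi_quot_ideal (SL (repr u) (repr v) (repr w))).
by rewrite /lie !(pi_quotB, pi_quotM).
Qed.

Section Induced.

Variables (B : algType K) (f : {lrmorphism A -> B}).

Definition induced (u : Q) : B := f (repr u).

Hypothesis fS : forall s, S s -> f s = 0.

Lemma induced_pi a : induced (\pi a) = f a.
Proof.
apply/eqP; rewrite -subr_eq0 -raddfB /=; apply/eqP.
have: repr (\pi_Q a) - a \in I by apply/pi_quotP; rewrite reprK.
elim/ideal_ind => [|x y x0 y0|b s c /fS fs0].
- exact: raddf0.
- by rewrite raddfD /= x0 y0 addr0.
by rewrite !rmorphM /= fs0 mulr0 mul0r.
Qed.

Lemma inducedB : zmod_morphism induced.
Proof.
by move=> x y; rewrite -[x]reprK -[y]reprK -pi_quotB !induced_pi raddfB.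
Qed.

Lemma inducedM : monoid_morphism induced.
Proof.
split=> [|x y]; first by rewrite -pi_quot1 induced_pi rmorph1.
by rewrite -[x]reprK -[y]reprK -pi_quotM !induced_pi rmorphM.
Qed.

Lemma inducedZ : scalable induced.
Proof.
by move=> c x; rewrite -[x]reprK -pi_quotZ !induced_pi linearZ.
Qed.

End Induced.

End QuotientAlgebra.

Lemma malg_scaleAr (K : fieldType) (M : monomType) (c : K)
  (x y : {malg K[M]}) : c *: (x * y) = x * (c *: y).
Proof.
apply/malgP => m; rewrite monalg.mcoeffZ monalg.mcoeffMl.
rewrite (monalg.mcoeffMlw m (finmap.fsubset_refl _) (monalg.msuppZ_le c y)).
rewrite mulr_sumr; apply: eq_bigr => i _; rewrite mulr_sumr.
by apply: eq_bigr => j _; rewrite monalg.mcoeffZ mulrnAr mulrCA.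
Qed.

Section FreeAlgebra.

Variables (K : fieldType) (n : nat).

(* K<x_1, ..., x_n>, the algebra of the free monoid on n letters *)
Definition freeAlg : Type := {malg K[{fmonom 'I_n}]}.
HB.instance Definition _ := GRing.Lalgebra.on freeAlg.
HB.instance Definition _ := GRing.Lalgebra_isAlgebra.Build K freeAlg
  (@malg_scaleAr K {fmonom 'I_n}).

Definition letter (i : 'I_n) : freeAlg := << fmu i >>.

Section Substitution.

Variables (A : algType K) (g : 'I_n -> A).

Definition word_eval (m : {fmonom 'I_n}) : A := \prod_(i <- m) g i.

Fact word_eval_mmorphism : mmorphism word_eval.
Proof.
split=> [m1 m2|]; rewrite /word_eval; first by rewrite fmM big_cat.
by rewrite fm1 big_nil.
Qed.
HB.instance Definition _ :=
  isMultiplicative.Build {fmonom 'I_n} A word_eval word_eval_mmorphism.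

Definition freeSubst (a : freeAlg) : A := monalg.mmap (in_alg A) word_eval a.

Fact freeSubst_zmod_morphism : zmod_morphism freeSubst.
Proof. exact: monalg.mmapB. Qed.
HB.instance Definition _ :=
  GRing.isZmodMorphism.Build freeAlg A freeSubst freeSubst_zmod_morphism.

Fact freeSubst_monoid_morphism : monoid_morphism freeSubst.
Proof.
have [|hM h1] := monalg.commr_mmap_is_multiplicative
  (f := in_alg A) (h := word_eval); last by split.
by move=> a m m'; rewrite /GRing.comm /= -scalerAl -scalerAr mul1r mulr1.
Qed.
HB.instance Definition _ :=
  GRing.isMonoidMorphism.Build freeAlg A freeSubst freeSubst_monoid_morphism.

Fact freeSubst_scalable : scalable freeSubst.
Proof.
by move=> c a; rewrite /freeSubst monalg.mmapZ /= -scalerAl mul1r.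
Qed.
HB.instance Definition _ :=
  GRing.isScalable.Build K freeAlg A *:%R freeSubst freeSubst_scalable.

Lemma freeSubst_letter i : freeSubst (letter i) = g i.
Proof.
by rewrite /freeSubst monalg.mmapU /= scale1r mul1r /word_eval fmU big_seq1.
Qed.

End Substitution.

Lemma freeAlg_elim (P : freeAlg -> Prop) : P 1 -> (forall i, P (letter i)) ->
  (forall c x y, P x -> P y -> P (c *: x + y)) ->
  (forall x y, P x -> P y -> P (x * y)) -> forall x, P x.
Proof.
move=> P1 Pg PZD PM.
have P0: P 0 by rewrite -[0](addrN 1) addrC -scaleN1r; apply: PZD.
move=> a; rewrite (monalgE a).
elim/big_ind: _ => [//|b c Pb Pc|[m] _].
  by rewrite -[b]scale1r; apply: PZD.
have -> : << monalg.mcoeff (FMonom m) a *g FMonom m >>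
    = monalg.mcoeff (FMonom m) a *: << FMonom m >> :> freeAlg.
  by apply/malgP => k; rewrite monalg.mcoeffZ !monalg.mcoeffU mulrnAr mulr1.
rewrite -[_ *: _]addr0; apply: PZD => //.
elim: m => [|i m Pm]; first by rewrite -fmoneE.
suff -> : << FMonom (i :: m) >> = letter i * << FMonom m >> :> freeAlg.
  exact: PM.
rewrite -[RHS]/(fgmul _ _) fgmulUU mulr1; congr (<< _ >>).
by apply/val_inj; rewrite /= fmM fmU.
Qed.

Definition freeAlg_aug : freeAlg -> K := @monalg.mcoeff {fmonom 'I_n} K mone.
HB.instance Definition _ := GRing.RMorphism.on freeAlg_aug.

End FreeAlgebra.

Section RelativelyFree.

Variables (K : fieldType) (n : nat).

Lemma identities_proper :
  1 \notin two_sided_ideal (@is_double_commutator (freeAlg K n)).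
Proof. exact: (one_notin_double_commutator_ideal (@freeAlg_aug K n)). Qed.

Definition relFree : Type := quotAlg identities_proper.
HB.instance Definition _ := GRing.Algebra.on relFree.
HB.instance Definition _ := Quotient.on relFree.

Definition gen (i : 'I_n) : relFree := \pi_relFree (letter K i).

Lemma relFree_identity (u v w : relFree) : lie (lie u v) w = 0.
Proof.
by apply: quot_identity => a b c; exists a, b, c.
Qed.

Section Substitution.

Variables (A : algType K) (g : 'I_n -> A).

(* The homomorphism that maps the generators to the g i, provided that A
   satisfies [[u, v], w] = 0. *)
Definition subst : relFree -> A := induced (freeSubst g).

Hypothesis A_identity : forall u v w : A, lie (lie u v) w = 0.

Let kill s : is_double_commutator s -> freeSubst g s = 0.
Proof.
by move=> [u [v [w ->]]]; rewrite !rmorph_lie A_identity.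
Qed.

Lemma subst_zmod_morphism : zmod_morphism subst.
Proof. exact: inducedB kill. Qed.

Lemma subst_monoid_morphism : monoid_morphism subst.
Proof. exact: inducedM kill. Qed.

Lemma subst_scalable : scalable subst.
Proof. exact: inducedZ kill. Qed.

Lemma subst_gen i : subst (gen i) = g i.
Proof. exact: etrans (induced_pi _ kill _) (freeSubst_letter _ _). Qed.

End Substitution.

Lemma relFree_elim (P : relFree -> Prop) : P 1 -> (forall i, P (gen i)) ->
  (forall c x y, P x -> P y -> P (c *: x + y)) ->
  (forall x y, P x -> P y -> P (x * y)) -> forall x, P x.
Proof.
move=> P1 Pg PZD PM x; rewrite -[x]reprK; move: (repr x).
elim/freeAlg_elim => [|i|c a b Pa Pb|a b Pa Pb].
- by rewrite pi_quot1.
- exact: Pg.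
- by rewrite pi_quotD pi_quotZ; apply: PZD.
- by rewrite pi_quotM; apply: PM.
Qed.

End RelativelyFree.

(* F' = F[F, F]F *)
Definition comm_ideal (R : nzRingType) : {pred R} :=
  two_sided_ideal (@is_commutator R).
Arguments comm_ideal R : clear implicits.
HB.instance Definition _ R := GRing.ZmodClosed.on (comm_ideal R).

(* The value of p at x_1, ..., x_n in a possibly non-commutative algebra, where
   the monomial of exponent (a_1, ..., a_n) is x_1^a_1 ... x_n^a_n in this
   order. *)
Definition ordEval (K : fieldType) n (F : algType K) (x : 'I_n -> F)
  (p : {mpoly K[n]}) : F := mpoly.mmap (in_alg F) x p.

Section ThreeGenerators.

Variables (K : fieldType) (F : algType K) (x : 'I_3 -> F).

Hypothesis F_identity : forall u v w : F, lie (lie u v) w = 0.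

Lemma lie_central (u v w : F) : lie u v * w = w * lie u v.
Proof. by apply/eqP; rewrite -subr_eq0; apply/eqP/F_identity. Qed.

Lemma lieMl (u v w : F) : lie (u * v) w = u * lie v w + lie u w * v.
Proof. by rewrite /lie mulrBr mulrBl !mulrA addrA subrK. Qed.

Lemma lieMr (u v w : F) : lie u (v * w) = lie u v * w + v * lie u w.
Proof. by rewrite /lie mulrBr mulrBl !mulrA addrA subrK. Qed.

Lemma lieDl (u v w : F) : lie (u + v) w = lie u w + lie v w.
Proof. by rewrite /lie mulrDl mulrDr opprD addrACA. Qed.

Lemma lieZl c (u v : F) : lie (c *: u) v = c *: lie u v.
Proof. by rewrite /lie -scalerAl -scalerAr scalerBr. Qed.

Lemma lie_opp (u v : F) : lie u v = - lie v u.
Proof. by rewrite /lie opprB. Qed.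

Lemma lie_uu (u : F) : lie u u = 0.
Proof. exact: subrr. Qed.

Lemma lie_mul_lie (a b c : F) : lie a b * lie c b = 0.
Proof.
have := F_identity a (b * c) b => /eqP.
rewrite (@lieMr a) addrC lieDl !lieMl !F_identity lie_uu.
by rewrite !(mulr0, mul0r, addr0, add0r) => /eqP.
Qed.

Hypothesis F_elim : forall P : F -> Prop, P 1 -> (forall i, P (x i)) ->
  (forall c u v, P u -> P v -> P (c *: u + v)) ->
  (forall u v, P u -> P v -> P (u * v)) -> forall u, P u.

Lemma gen_lie_mul_lie i j (u v : F) : lie (x i) (x j) * lie u v = 0.
Proof.
pose e := lie (x i) (x j).
have closed (w : F) : (forall k, e * lie (x k) w = 0) ->
    forall z, e * lie z w = 0.
  move=> eg; elim/F_elim => // [|c y z ey ez|y z ey ez].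
  - by rewrite /lie mul1r mulr1 subrr mulr0.
  - by rewrite lieDl lieZl mulrDr -scalerAr ey ez scaler0 addr0.
  rewrite lieMl mulrDr (mulrA e y) (mulrA e (lie y w)) ey mul0r addr0.
  by rewrite (lie_central (x i)) -mulrA ez mulr0.
apply: (closed) => k; rewrite lie_opp mulrN; apply/eqP; rewrite oppr_eq0.
apply/eqP; apply: (closed) => l; rewrite /e.
have [->|ij] := eqVneq i j; first by rewrite lie_uu mul0r.
have [->|kl] := eqVneq k l; first by rewrite lie_uu mulr0.
have [->|jk] := eqVneq j k; first by rewrite lie_mul_lie.
have [->|jl] := eqVneq j l.
  by rewrite [X in _ * X]lie_opp mulrN lie_mul_lie oppr0.
have [->|ik] := eqVneq i k.
  by rewrite [X in X * _]lie_opp mulNr lie_mul_lie oppr0.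
have [->|il] := eqVneq i l.
  by rewrite lie_opp [X in _ * X]lie_opp mulrNN lie_mul_lie.
by case: i j k l {e closed} ij kl jk jl ik il => [[|[|[|?]]] ?] [[|[|[|?]]] ?]
  [[|[|[|?]]] ?] [[|[|[|?]]] ?].
Qed.

Lemma gen_commute i j (w : F) : w \in comm_ideal F ->
  x i * (x j * w) = x j * (x i * w).
Proof.
move=> wF; apply/eqP; rewrite -subr_eq0 !mulrA -mulrBl; apply/eqP.
elim/ideal_ind: wF => [|y z ey ez|a _ b [u [v ->]]]; first exact: mulr0.
  by rewrite mulrDr ey ez addr0.
rewrite -/(lie _ _) !mulrA lie_central -(mulrA a) gen_lie_mul_lie.
by rewrite mulr0 mul0r.
Qed.

Lemma genX_commute i j a b (w : F) : w \in comm_ideal F ->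
  x i ^+ a * (x j ^+ b * w) = x j ^+ b * (x i ^+ a * w).
Proof.
have one c z : z \in comm_ideal F ->
    x i * (x j ^+ c * z) = x j ^+ c * (x i * z).
  elim: c z => [|c IH] z zF; first by rewrite !mul1r.
  rewrite exprSr.
  rewrite -!mulrA.
  rewrite IH; last exact: idealMl.
  by rewrite gen_commute.
move=> wF; elim: a => [|a IH]; first by rewrite !mul1r.
by rewrite exprS -!mulrA IH one //; apply: idealMl.
Qed.

Lemma ordEvalXm m :
  ordEval x 'X_[m] = x 0 ^+ m 0 * x 1 ^+ m 1 * x 2 ^+ m 2.
Proof.
rewrite /ordEval mmapX /mmap1 !big_ord_recl big_ord0 mulr1 mulrA.
by congr (x _ ^+ m _ * x _ ^+ m _ * x _ ^+ m _); apply/val_inj.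
Qed.

Lemma ordEvalD p q : ordEval x (p + q) = ordEval x p + ordEval x q.
Proof. exact: raddfD. Qed.

Lemma ordEval0 : ordEval x 0 = 0.
Proof. exact: raddf0. Qed.

Lemma ordEvalZ c p : ordEval x (c *: p) = c *: ordEval x p.
Proof. by rewrite /ordEval mmapZ /= -scalerAl mul1r. Qed.

Lemma ordEval1 : ordEval x 1 = 1.
Proof. by rewrite /ordEval -mpolyC1 mmapC /= scale1r. Qed.

Lemma ordEvalX i : ordEval x 'X_i = x i.
Proof. by rewrite /ordEval mmapX mmap1U. Qed.

Lemma ordEvalM p q (w : F) : w \in comm_ideal F ->
  ordEval x (p * q) * w = ordEval x p * (ordEval x q * w).
Proof.
move=> wF; elim/mpolyind: p => [|c m p _ _ IHp].
  by rewrite mul0r ordEval0 !mul0r.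
rewrite mulrDl !ordEvalD !mulrDl IHp; congr (_ + _) => {p IHp}.
rewrite -scalerAl !ordEvalZ -!scalerAl; congr (_ *: _) => {c}.
elim/mpolyind: q => [|c k q _ _ IHq].
  by rewrite mulr0 ordEval0 !mul0r mulr0.
rewrite mulrDr !ordEvalD !mulrDl mulrDr IHq; congr (_ + _) => {q IHq}.
rewrite -scalerAr !ordEvalZ -!scalerAl -scalerAr; congr (_ *: _) => {c}.
rewrite -mpolyXD !ordEvalXm !mnmDE !exprD -!mulrA.
have wI a u : u \in comm_ideal F -> a * u \in comm_ideal F by apply: idealMl.
congr (_ * _).
rewrite [x 2 ^+ m 2 * (x 0 ^+ _ * _)]genX_commute; last by rewrite ?wI.
rewrite [x 1 ^+ m 1 * (x 0 ^+ _ * _)]genX_commute; last by rewrite ?wI.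
congr (_ * (_ * _)).
by rewrite [x 2 ^+ m 2 * (x 1 ^+ _ * _)]genX_commute; last by rewrite ?wI.
Qed.

Lemma ordEval_msym (phi : {lrmorphism F -> F}) (s : 'S_3) p (w : F) :
  (forall i, phi (x i) = x (s i)) -> w \in comm_ideal F ->
  phi (ordEval x p) * w = ordEval x (msym s p) * w.
Proof.
move=> phix wF; elim/mpolyind: p => [|c m p _ _ IHp].
  by rewrite msym0 ordEval0 raddf0.
rewrite msymD msymZ !ordEvalD !ordEvalZ raddfD /= linearZ /= !mulrDl IHp.
congr (_ + _) => {p IHp}; rewrite -!scalerAl; congr (_ *: _).
have wI a u : u \in comm_ideal F -> a * u \in comm_ideal F by apply: idealMl.
have evX i k u : u \in comm_ideal F ->
    ordEval x ('X_i ^+ k) * u = x i ^+ k * u.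
  elim: k u => [|k IHk] u uF; first by rewrite !expr0 ordEval1.
  by rewrite !exprS ordEvalM // ordEvalX IHk // mulrA.
rewrite /msym mmapX /mmap1 ordEvalXm !big_ord_recl big_ord0 mulr1.
rewrite !rmorphM !rmorphXn /= !phix !ordEvalM // !evX ?wI // -!mulrA.
by congr (x (s _) ^+ m _ * (x (s _) ^+ m _ * (x (s _) ^+ m _ * w)));
  apply/val_inj.
Qed.

End ThreeGenerators.

Section SymmetricElements.

Variable K : fieldType.
Local Notation F3 := (relFree K 3).
Local Notation x := (@gen K 3).

Definition permF3 (s : 'S_3) : F3 -> F3 := subst (fun i => x (s i)).

HB.instance Definition _ s := GRing.isZmodMorphism.Build F3 F3 (permF3 s)
  (subst_zmod_morphism _ (@relFree_identity K 3)).
HB.instance Definition _ s := GRing.isMonoidMorphism.Build F3 F3 (permF3 s)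
  (subst_monoid_morphism _ (@relFree_identity K 3)).
HB.instance Definition _ s := GRing.isScalable.Build K F3 F3 *:%R (permF3 s)
  (subst_scalable _ (@relFree_identity K 3)).

Lemma permF3_gen s i : permF3 s (x i) = x (s i).
Proof. exact: subst_gen (@relFree_identity K 3) i. Qed.

Record F3' : Type := CommElt {
  commElt_val :> F3;
  commElt_subproof : commElt_val \in comm_ideal F3 }.
HB.instance Definition _ := [isSub for commElt_val].
HB.instance Definition _ := [Choice of F3' by <:].
HB.instance Definition _ := [SubChoice_isSubZmodule of F3' by <:].

Definition scaleF3' (p : {mpoly K[3]}) (w : F3') : F3' :=
  CommElt (idealMl (ordEval x p) (commElt_subproof w)).

Fact scaleF3'A p q w : scaleF3' p (scaleF3' q w) = scaleF3' (p * q) w.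
Proof.
apply/val_inj/esym; apply: ordEvalM (commElt_subproof w).
  exact: relFree_identity.
exact: relFree_elim.
Qed.

Fact scaleF3'1 : left_id 1 scaleF3'.
Proof. by move=> w; apply/val_inj; rewrite /= ordEval1 mul1r. Qed.

Fact scaleF3'Dr : right_distributive scaleF3' +%R.
Proof. by move=> p v w; apply/val_inj; exact: mulrDr. Qed.

Fact scaleF3'Dl w : {morph scaleF3'^~ w : p q / p + q}.
Proof.
by move=> p q; apply/val_inj; rewrite /= ordEvalD; exact: mulrDl.
Qed.

HB.instance Definition _ := GRing.Zmodule_isLmodule.Build {mpoly K[3]} F3'
  scaleF3'A scaleF3'1 scaleF3'Dr scaleF3'Dl.

(* K[X_3]^{S_3} *)
Record symPoly : Type := SymPoly {
  symPoly_val :> {mpoly K[3]};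
  symPoly_subproof : symPoly_val \in (@symmetric_pred 3 K) }.
HB.instance Definition _ := [isSub for symPoly_val].
HB.instance Definition _ := [Choice of symPoly by <:].
HB.instance Definition _ := [SubChoice_isSubComNzRing of symPoly by <:].

Definition symF3'_pred : {pred F3'} :=
  fun w => [forall s : 'S_3, permF3 s (val w) == val w].

Fact symF3'_zmod_closed : zmod_closed symF3'_pred.
Proof.
split=> [|v w /forallP hv /forallP hw]; apply/forallP => s.
  by rewrite raddf0 raddf0.
apply/eqP; transitivity (permF3 s (val v) - permF3 s (val w)).
  exact: raddfB.
by rewrite (eqP (hv s)) (eqP (hw s)).
Qed.
HB.instance Definition _ :=
  GRing.isZmodClosed.Build F3' symF3'_pred symF3'_zmod_closed.

(* (F_3')^{S_3} *)
Record symF3' : Type := SymElt {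
  symElt_val :> F3';
  symElt_subproof : symElt_val \in symF3'_pred }.
HB.instance Definition _ := [isSub for symElt_val].
HB.instance Definition _ := [Choice of symF3' by <:].
HB.instance Definition _ := [SubChoice_isSubZmodule of symF3' by <:].

Fact scale_symF3'_subproof (p : symPoly) (w : symF3') :
  val p *: val w \in symF3'_pred.
Proof.
apply/forallP => s; apply/eqP.
have /forallP/(_ s)/eqP sw := valP w; have /forallP/(_ s)/eqP sp := valP p.
rewrite rmorphM /= sw -[in RHS]sp.
apply: ordEval_msym (commElt_subproof (val w)); [| |exact: permF3_gen].
  exact: relFree_identity.
exact: relFree_elim.
Qed.

Definition scale_symF3' (p : symPoly) (w : symF3') : symF3' :=
  SymElt (scale_symF3'_subproof p w).

Fact scale_symF3'A p q w :
  scale_symF3' p (scale_symF3' q w) = scale_symF3' (p * q) w.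
Proof. by apply/val_inj; exact: scalerA. Qed.

Fact scale_symF3'1 : left_id 1 scale_symF3'.
Proof. by move=> w; apply/val_inj; exact: scale1r. Qed.

Fact scale_symF3'Dr : right_distributive scale_symF3' +%R.
Proof. by move=> p v w; apply/val_inj; exact: scalerDr. Qed.

Fact scale_symF3'Dl w : {morph scale_symF3'^~ w : p q / p + q}.
Proof. by move=> p q; apply/val_inj; exact: scalerDl. Qed.

HB.instance Definition _ := GRing.Zmodule_isLmodule.Build symPoly symF3'
  scale_symF3'A scale_symF3'1 scale_symF3'Dr scale_symF3'Dl.

Section Generators.

Local Notation x1 := (x 0).
Local Notation x2 := (x 1).
Local Notation x3 := (x 2).

Definition f010_val : F3 :=
  (x2 - x1) * lie x2 x1 + (x3 - x1) * lie x3 x1 + (x3 - x2) * lie x3 x2.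

Definition f020_val : F3 :=
  (x2 ^+ 2 - x1 ^+ 2) * lie x2 x1 + (x3 ^+ 2 - x1 ^+ 2) * lie x3 x1
  + (x3 ^+ 2 - x2 ^+ 2) * lie x3 x2.

Definition f120_val : F3 :=
  (x1 * x2 ^+ 2 - x1 ^+ 2 * x2) * lie x2 x1
  + (x1 * x3 ^+ 2 - x1 ^+ 2 * x3) * lie x3 x1
  + (x2 * x3 ^+ 2 - x2 ^+ 2 * x3) * lie x3 x2.

Fact sum_lie_in_comm_ideal (a b c u v w u' v' w' : F3) :
  a * lie u u' + b * lie v v' + c * lie w w' \in comm_ideal F3.
Proof.
have memP d y z : d * lie y z \in comm_ideal F3.
  by apply/idealMl/mem_ideal; exists y, z.
by rewrite !rpredD.
Qed.

Fact permF3_sum (s : 'S_3) (T : 'I_3 -> 'I_3 -> F3) :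
  (forall i j, permF3 s (T i j) = T (s i) (s j)) ->
  (forall i j, T i j = T j i) ->
  permF3 s (T 0 1 + T 0 2 + T 1 2) = T 0 1 + T 0 2 + T 1 2.
Proof.
move=> sT TC; rewrite !raddfD /= !sT.
have ij (i j : 'I_3) : i != j -> s i != s j by rewrite (inj_eq perm_inj).
have : [/\ s 0 != s 1, s 0 != s 2 & s 1 != s 2] by split; apply: ij.
have ordE (k : 'I_3) : [\/ k = 0, k = 1 | k = 2].
  by case: k => [[|[|[|//]]] ?]; [constructor 1|constructor 2|constructor 3];
    apply/val_inj.
case: (ordE (s 0)) => ->; case: (ordE (s 1)) => ->; case: (ordE (s 2)) => ->;
  move=> [] //; rewrite ?(TC 1 0) ?(TC 2 0) ?(TC 2 1) => _ _ _.
- by rewrite (ACl (2*1*3)).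
- by rewrite (ACl (1*3*2)).
- by rewrite (ACl (2*3*1)).
- by rewrite (ACl (3*1*2)).
- by rewrite (ACl (3*2*1)).
Qed.

Fact f010_comm : f010_val \in comm_ideal F3.
Proof. exact: sum_lie_in_comm_ideal. Qed.

Fact f020_comm : f020_val \in comm_ideal F3.
Proof. exact: sum_lie_in_comm_ideal. Qed.

Fact f120_comm : f120_val \in comm_ideal F3.
Proof. exact: sum_lie_in_comm_ideal. Qed.

Fact f010_sym : CommElt f010_comm \in symF3'_pred.
Proof.
apply/forallP => s; apply/eqP.
apply: (@permF3_sum s (fun i j => (x j - x i) * lie (x j) (x i))) => i j.
  by rewrite rmorphM rmorphB rmorph_lie /= !permF3_gen.
by rewrite -(opprB (x i)) (lie_opp (x j)) mulrNN.
Qed.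

Fact f020_sym : CommElt f020_comm \in symF3'_pred.
Proof.
apply/forallP => s; apply/eqP.
apply: (@permF3_sum s
  (fun i j => (x j ^+ 2 - x i ^+ 2) * lie (x j) (x i))) => i j.
  by rewrite rmorphM rmorphB rmorph_lie !rmorphXn /= !permF3_gen.
by rewrite -(opprB (x i ^+ 2)) (lie_opp (x j)) mulrNN.
Qed.

Fact f120_sym : CommElt f120_comm \in symF3'_pred.
Proof.
apply/forallP => s; apply/eqP.
apply: (@permF3_sum s
  (fun i j => (x i * x j ^+ 2 - x i ^+ 2 * x j) * lie (x j) (x i))) => i j.
  by rewrite rmorphM rmorphB rmorph_lie !rmorphM /= !permF3_gen.
have LI : lie (x j) (x i) \in comm_ideal F3 by apply: mem_ideal; do 2!eexists.
have com k l a b := genX_commute (@relFree_identity K 3) (@relFree_elim K 3)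
  k l a b LI.
have h1 : x i * x j ^+ 2 * lie (x j) (x i) = x j ^+ 2 * x i * lie (x j) (x i).
  by rewrite -(mulrA (x i)) -(mulrA (x j ^+ 2)); exact: (com i j 1 2).
have h2 : x i ^+ 2 * x j * lie (x j) (x i) = x j * x i ^+ 2 * lie (x j) (x i).
  by rewrite -(mulrA (x i ^+ 2)) -(mulrA (x j)); exact: (com i j 2 1).
by rewrite (lie_opp (x i)) mulrN -mulNr opprB !mulrBl h1 h2.
Qed.

Definition f010 : symF3' := SymElt f010_sym.
Definition f020 : symF3' := SymElt f020_sym.
Definition f120 : symF3' := SymElt f120_sym.

End Generators.

End SymmetricElements.

Section Generation.

Variables (R : nzRingType) (V : lmodType R).

Definition generates (S : V -> Prop) : Prop := forall v : V,
  exists r : seq (R * V),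
    (forall t, t \in r -> S t.2) /\ v = \sum_(t <- r) t.1 *: t.2.

Definition minimal_generating_set (S : V -> Prop) : Prop :=
  generates S /\
  forall T : V -> Prop, (forall v, T v -> S v) -> generates T ->
    forall v, S v -> T v.

Definition freely_generated_by n (f : n.-tuple V) : Prop := forall v : V,
  exists! c : {ffun 'I_n -> R}, v = \sum_(i < n) c i *: tnth f i.

End Generation.

(* Main.v *)
Require Import Defs.
From HB Require Import structures.
From mathcomp Require Import all_boot all_algebra.
From mathcomp Require Import perm boolp.
From mathcomp Require Import mpoly ring.

Set Implicit Arguments.
Unset Strict Implicit.
Unset Printing Implicit Defensive.

Import GRing.Theory.
Local Open Scope ring_scope.

(** Every element of the commutator ideal of F_3 is a combination
    p [x_2, x_1] + q [x_3, x_1] + r [x_3, x_2] with p, q, r in K[X_3]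
    ([comm_ideal_comb]).  The permutations of the variables permute the three
    commutators up to sign, so a symmetric element is determined by p alone
    ([symCoef_inj]), and the transposition of x_1 and x_2, which reverses
    [x_2, x_1], forces p to change sign ([symCoef_antisym]).  Hence
    p = b (x_2 - x_1) with b symmetric in x_1 and x_2.

    The polynomials symmetric in x_1 and x_2 form a free module over
    K[X_3]^{S_3} with basis 1, x_1 + x_2, x_1 x_2
    ([antisymmetric_pair_span], [pair_basis_free]).  As f_{0,1,0}, f_{0,2,0} and
    f_{1,2,0} have b = 1, x_1 + x_2 and x_1 x_2, they are a basis of
    (F_3')^{S_3}; and a basis of a module is always a minimal generating set
    ([freely_generated_minimal]).

    For this argument the coefficient p must be well defined, that is, there
    must be a K-linear map on F_3 that reads it off.  It comes from an algebra
    that satisfies [[u, v], w] = 0: the extension of K[X_3] by itself whose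
    product carries the 2-cocycle d_2 f . d_1 g, where d_i is the partial
    derivative in x_i ([cocycleExt], [commCoefE]). *)

(** * Free generation and minimality *)

(** If a basis vector v were outside a generating subset T of the basis, v would
    be a combination in which v has coefficient 0; uniqueness of coordinates
    would then give 0 = 1. *)
Lemma freely_generated_minimal (R : nzRingType) (V : lmodType R) n
    (f : n.-tuple V) :
  freely_generated_by f -> minimal_generating_set (fun v : V => v \in f).
Proof.
move=> free_f; split=> [v|T Tf genT v vf].
  have [c [-> _]] := free_f v.
  exists [seq (c i, tnth f i) | i <- enum 'I_n]; split.
    by move=> t /mapP[i _ ->]; apply: mem_tnth.
  by rewrite big_map big_enum.
have [[i def_v]|noti] := pselect (exists i, T (tnth f i) /\ v = tnth f i).
  by have [? ->] := def_v.
have /tnthP[i def_v] := vf.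
have [r [Tr def_vr]] := genT v.
suff [c ci0 def_vc] : exists2 c : {ffun 'I_n -> R}, c i = 0
    & v = \sum_(j < n) c j *: tnth f j.
  pose d := [ffun j => (j == i)%:R : R].
  have def_vd : v = \sum_(j < n) d j *: tnth f j.
    rewrite (bigD1 i) //= ffunE eqxx scale1r big1 ?addr0 // => j ji.
    by rewrite ffunE (negPf ji) scale0r.
  have [e [_ uniq_e]] := free_f v.
  have /ffunP/(_ i) := etrans (esym (uniq_e c def_vc)) (uniq_e d def_vd).
  by rewrite ci0 ffunE eqxx => /eqP; rewrite eq_sym oner_eq0.
(* Collect the terms of the combination r basis vector by basis vector; none of
   them involves the i-th one, because T does not contain it. *)
rewrite {vf}def_vr; elim: r Tr => [|[a w] r IHr] Tr.
  exists [ffun=> 0]; rewrite ?ffunE // big_nil big1 // => j _.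
  by rewrite ffunE scale0r.
have [|c ci0 def_c] := IHr.
  by move=> t tr; apply: Tr; rewrite inE tr orbT.
have Tw : T w by apply: (Tr (a, w)); rewrite inE eqxx.
have /tnthP[j def_w] := Tf w Tw.
exists [ffun k => (if k == j then a else 0) + c k].
  rewrite ffunE ci0 addr0; case: eqP => // ij.
  by case: noti; exists i; rewrite -def_v; split=> //; rewrite def_v ij -def_w.
rewrite big_cons /= def_c def_w; under [RHS]eq_bigr do rewrite ffunE scalerDl.
rewrite big_split /=; congr (_ + _); rewrite (bigD1 j) //= eqxx big1 ?addr0 //.
by move=> k /negPf->; rewrite scale0r.
Qed.

(** * Polynomials symmetric in two of three variables *)

Lemma ord3_ind (P : 'I_3 -> Prop) : P 0 -> P 1 -> P 2 -> forall i, P i.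
Proof.
move=> P0 P1 P2 [[|[|[|//]]] lt_i].
- by rewrite (_ : Ordinal _ = 0) //; apply/val_inj.
- by rewrite (_ : Ordinal _ = 1) //; apply/val_inj.
by rewrite (_ : Ordinal _ = 2) //; apply/val_inj.
Qed.

Lemma sum3E (V : nmodType) (F : 'I_3 -> V) : \sum_i F i = F 0 + F 1 + F 2.
Proof.
rewrite !big_ord_recl big_ord0 addr0 addrA.
by congr (_ + F _ + F _); apply/val_inj.
Qed.

Lemma prod3E (R : comNzRingType) (F : 'I_3 -> R) :
  \prod_i F i = F 0 * F 1 * F 2.
Proof.
rewrite !big_ord_recl big_ord0 mulr1 mulrA.
by congr (_ * F _ * F _); apply/val_inj.
Qed.

Section SymmetricPolynomials.

Variable K : fieldType.
Local Notation MP := {mpoly K[3]}.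
Local Notation X := (fun i => 'X_i : MP).
Local Notation X1 := ('X_0 : MP).
Local Notation X2 := ('X_1 : MP).
Local Notation X3 := ('X_2 : MP).

Lemma mpoly_elim n (P : {mpoly K[n]} -> Prop) : P 1 ->
  (forall c p q, P p -> P q -> P (c *: p + q)) ->
  (forall i p, P p -> P ('X_i * p)) -> forall p, P p.
Proof.
move=> P1 PZD PX; have P0 : P 0.
  by rewrite -[0](addrN 1) addrC -scaleN1r; apply: PZD.
apply: mpolyind => // c m p _ _; apply: PZD; rewrite mpolyXE_id.
elim/big_rec: _ => // i q _ Pq; elim: (m i) => [|k IHk]; first by rewrite mul1r.
by rewrite exprS -mulrA; apply: PX.
Qed.

Lemma msym_var n (s : 'S_n) i : msym s 'X_i = 'X_(s i) :> {mpoly K[n]}.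
Proof. by rewrite /msym mmapX mmap1U. Qed.

Lemma mpolyX_neq n (i j : 'I_n) : i != j -> 'X_i - 'X_j != 0 :> {mpoly K[n]}.
Proof.
rewrite subr_eq0 => ij; apply/eqP => /= /(congr1 (mcoeff U_(i))) /eqP.
by rewrite !mcoeffXU eqxx [j == i]eq_sym (negPf ij) oner_eq0.
Qed.

Definition sigma1 : MP := X1 + X2 + X3.
Definition sigma2 : MP := X1 * X2 + X1 * X3 + X2 * X3.
Definition sigma3 : MP := X1 * X2 * X3.

Lemma sigma1_sym : sigma1 \is symmetric.
Proof.
rewrite /sigma1 -(sum3E X); apply/issymP => s.
rewrite raddf_sum /= [RHS](reindex_inj (@perm_inj _ s)).
by apply: eq_bigr => i _; apply: msym_var.
Qed.

Lemma sigma3_sym : sigma3 \is symmetric.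
Proof.
rewrite /sigma3 -(prod3E X); apply/issymP => s.
rewrite rmorph_prod /= [RHS](reindex_inj (@perm_inj _ s)).
by apply: eq_bigr => i _; apply: msym_var.
Qed.

(** In three variables sigma2 is the sum over i of the product of the variables
    other than the i-th, a form in which a permutation only reindexes. *)
Lemma sigma2_sym : sigma2 \is symmetric.
Proof.
have -> : sigma2 = \sum_i \prod_(j | j != i) X j.
  by rewrite sum3E !(big_mkcond (fun j => j != _)) !prod3E /= /sigma2; ring.
apply/issymP => s; rewrite raddf_sum /= [RHS](reindex_inj (@perm_inj _ s)).
apply: eq_bigr => i _; rewrite rmorph_prod /=.
rewrite [RHS](reindex_inj (@perm_inj _ s)); apply: eq_big => [j|j _].
  by rewrite (inj_eq perm_inj).
exact: msym_var.
Qed.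

(** The K[X_3]^{S_3}-span of 1, x_1 + x_2 and x_1 x_2; it turns out to be the
    ring of polynomials symmetric in x_1 and x_2. *)
Definition pair_span (p : MP) : Prop := exists c : 'I_3 -> MP,
  (forall i, c i \is symmetric)
  /\ p = c 0 + c 1 * (X1 + X2) + c 2 * (X1 * X2).

Lemma pair_spanI a b c p : a \is symmetric -> b \is symmetric ->
  c \is symmetric -> p = a + b * (X1 + X2) + c * (X1 * X2) -> pair_span p.
Proof.
move=> sa sb sc ->; exists (tnth [tuple a; b; c]); split; last by [].
by elim/ord3_ind.
Qed.

Lemma pair_spanD p q : pair_span p -> pair_span q -> pair_span (p + q).
Proof.
move=> [c [cs ->]] [d [ds ->]].
apply: (@pair_spanI (c 0 + d 0) (c 1 + d 1) (c 2 + d 2)); last by ring.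
all: by rewrite rpredD.
Qed.

Lemma pair_spanM a p : a \is symmetric -> pair_span p -> pair_span (a * p).
Proof.
move=> sa [c [cs ->]].
apply: (@pair_spanI (a * c 0) (a * c 1) (a * c 2)); last by ring.
all: by rewrite rpredM.
Qed.

Lemma pair_spanZ k p : pair_span p -> pair_span (k *: p).
Proof.
move=> sp; rewrite -mul_mpolyC; apply: pair_spanM sp.
by apply/issymP => s; rewrite -[k%:MP]mulr1 mul_mpolyC msymZ msym1.
Qed.

Lemma pair_spanB p q : pair_span p -> pair_span q -> pair_span (p - q).
Proof.
by move=> ? /(pair_spanZ (-1)); rewrite scaleN1r; apply: pair_spanD.
Qed.

(** With u = x_1 + x_2 and v = x_1 x_2 the third variable is sigma1 - u, so that
    sigma2 = v + u (sigma1 - u) and sigma3 = v (sigma1 - u).  These relations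
    express u^2 and u v, and then v^2, in terms of 1, u, v; this makes the span
    closed under multiplication by u and, in the next lemma, by v. *)
Lemma pair_span_sumM p : pair_span p -> pair_span ((X1 + X2) * p).
Proof.
move=> [c [cs ->]].
have sM i a : a \is symmetric -> c i * a \is symmetric.
  by move=> sa; rewrite rpredM.
apply: (@pair_spanI (- (c 1 * sigma2 + c 2 * sigma3)) (c 0 + c 1 * sigma1)
  (c 1 + c 2 * sigma1)); last by rewrite /sigma1 /sigma2 /sigma3; ring.
all: by rewrite ?rpredN ?rpredD ?sM ?sigma1_sym ?sigma2_sym ?sigma3_sym.
Qed.

Lemma pair_span_prodM p : pair_span p -> pair_span (X1 * X2 * p).
Proof.
move=> [c [cs ->]].
have sM i a : a \is symmetric -> c i * a \is symmetric.
  by move=> sa; rewrite rpredM.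
apply: (@pair_spanI (- (c 1 * sigma3)) (- (c 2 * sigma3))
  (c 0 + c 1 * sigma1 + c 2 * sigma2));
  last by rewrite /sigma1 /sigma2 /sigma3; ring.
all: by rewrite ?rpredN ?rpredD ?sM ?sigma1_sym ?sigma2_sym ?sigma3_sym.
Qed.

(** The set of all a + b (x_2 - x_1) with a, b in [pair_span] contains 1 and is
    stable under every variable: with u = x_1 + x_2 and v = x_1 x_2 one has
    (x_2 - x_1)^2 = u^2 - 4 v, which keeps [pair_span] stable, x_3 = sigma1 - u,
    and x_1, x_2 = (u -+ (x_2 - x_1)) / 2. *)
Lemma pair_decomposition : (2 : K) != 0 -> forall p : MP,
  exists a b, [/\ pair_span a, pair_span b & p = a + b * (X2 - X1)].
Proof.
move=> nz2; elim/mpoly_elim.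
- exists 1, 0; split; last by rewrite mul0r addr0.
    by apply: (@pair_spanI 1 0 0); rewrite ?rpred0 ?rpred1 //; ring.
  by apply: (@pair_spanI 0 0 0); rewrite ?rpred0 //; ring.
- move=> c p q [a [b [sa sb ->]]] [a' [b' [sa' sb' ->]]].
  exists (c *: a + a'), (c *: b + b').
  split; try by apply: pair_spanD => //; apply: pair_spanZ.
  by rewrite scalerDr mulrDl scalerAl addrACA.
move=> i p [a [b [sa sb ->]]].
pose u := X1 + X2; pose v := X1 * X2.
have su q : pair_span q -> pair_span (u * q) by apply: pair_span_sumM.
have sv q : pair_span q -> pair_span (v * q) by apply: pair_span_prodM.
have s1 q : pair_span q -> pair_span (sigma1 * q).
  by apply/pair_spanM/sigma1_sym.
pose h : K := 2^-1.
have D2 q : pair_span q -> pair_span ((X2 - X1) ^+ 2 * q).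
  move=> sq; have -> : (X2 - X1) ^+ 2 * q = u * (u * q) - 4%:R *: (v * q).
    by rewrite scaler_nat /u /v; ring.
  by apply: pair_spanB; [apply/su/su | apply/pair_spanZ/sv].
have hK (q : MP) : h *: q + h *: q = q.
  by rewrite -scalerDl -mulr2n -[h *+ 2]mulr_natl divff // scale1r.
elim/ord3_ind: i.
- exists (h *: (u * a - (X2 - X1) ^+ 2 * b)), (h *: (u * b - a)); split.
  + by apply/pair_spanZ/pair_spanB; [apply: su | apply: D2].
  + by apply/pair_spanZ/pair_spanB; [apply: su|].
  rewrite -scalerAl -scalerDr.
  by rewrite -[LHS]hK -scalerDr; congr (_ *: _); rewrite /u; ring.
- exists (h *: (u * a + (X2 - X1) ^+ 2 * b)), (h *: (u * b + a)); split.
  + by apply/pair_spanZ/pair_spanD; [apply: su | apply: D2].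
  + by apply/pair_spanZ/pair_spanD; [apply: su|].
  rewrite -scalerAl -scalerDr.
  by rewrite -[LHS]hK -scalerDr; congr (_ *: _); rewrite /u; ring.
exists (sigma1 * a - u * a), (sigma1 * b - u * b); split.
- by apply: pair_spanB; [apply: s1 | apply: su].
- by apply: pair_spanB; [apply: s1 | apply: su].
by rewrite /sigma1 /u; ring.
Qed.

(** The transposition of x_1 and x_2 fixes [pair_span] and negates x_2 - x_1, so
    antisymmetry kills the summand a of the decomposition a + b (x_2 - x_1). *)
Lemma antisymmetric_pair_span (p : MP) : (2 : K) != 0 ->
  msym (tperm 0 1) p = - p -> exists2 b, pair_span b & p = b * (X2 - X1).
Proof.
move=> nz2; have [a [b [sa sb ->]]] := pair_decomposition nz2 p.
have fix_span q : pair_span q -> msym (tperm 0 1) q = q.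
  move=> [c [/(_ _)/issymP cs ->]].
  rewrite !(msymD, msymM) !msym_var tpermL tpermR !cs.
  by rewrite (addrC X2) (mulrC X2).
rewrite msymD msymM msymB !msym_var tpermL tpermR !fix_span // => Ea.
have a0 : a + a = 0.
  have -> : a + a = a + b * (X1 - X2) + (a + b * (X2 - X1)) by ring.
  by rewrite Ea addNr.
exists b => //; suff -> : a = 0 by rewrite add0r.
apply/eqP; move/eqP: a0; rewrite -mulr2n -scaler_nat scaler_eq0.
by rewrite (negPf nz2).
Qed.

(** Permuting the variables in a relation and subtracting eliminates the
    coefficients one at a time: exchanging x_1 and x_3 and dividing by x_1 - x_3
    leaves c1 + c2 x_2 = 0, and exchanging x_2 and x_3 there leaves c2 = 0. *)
Lemma pair_basis_free (c0 c1 c2 : MP) :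
  c0 \is symmetric -> c1 \is symmetric -> c2 \is symmetric ->
  c0 + c1 * (X1 + X2) + c2 * (X1 * X2) = 0 -> [/\ c0 = 0, c1 = 0 & c2 = 0].
Proof.
move=> /issymP s0 /issymP s1 /issymP s2 E.
have E13 : c0 + c1 * (X3 + X2) + c2 * (X3 * X2) = 0.
  have /(congr1 (msym (tperm 0 2))) := E.
  rewrite !(msymD, msymM) !msym_var tpermL tpermD // s0 s1 s2.
  by rewrite msym0.
have E1 : c1 + c2 * X2 = 0.
  have /eqP : (c1 + c2 * X2) * (X1 - X3) = 0.
    transitivity (c0 + c1 * (X1 + X2) + c2 * (X1 * X2)
      - (c0 + c1 * (X3 + X2) + c2 * (X3 * X2))); first by ring.
    by rewrite E E13 subrr.
  rewrite mulf_eq0 (negPf (mpolyX_neq (erefl : (0 : 'I_3) != 2))) orbF.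
  by move/eqP.
have E1' : c1 + c2 * X3 = 0.
  have /(congr1 (msym (tperm 1 2))) := E1.
  by rewrite !(msymD, msymM) !msym_var tpermL s1 s2 msym0.
have c2_0 : c2 = 0.
  have /eqP : c2 * (X2 - X3) = 0.
    transitivity (c1 + c2 * X2 - (c1 + c2 * X3)); first by ring.
    by rewrite E1 E1' subrr.
  rewrite mulf_eq0 (negPf (mpolyX_neq (erefl : (1 : 'I_3) != 2))) orbF.
  by move/eqP.
by move: E E1; rewrite c2_0 !mul0r !addr0 => E c1_0; move: E;
  rewrite c1_0 mul0r addr0.
Qed.

End SymmetricPolynomials.

(** * The coefficient of a commutator *)

Section CocycleExtension.

Variables (K : fieldType) (n : nat) (i j : 'I_n).

(** The extension of K[X] by the square-zero module K[X] with product
    (p, a) (q, b) = (p q, p b + a q + d_i p . d_j q).  It is associative because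
    d_i and d_j are derivations, and a commutator lies in the second component,
    which is central; hence [[u, v], w] = 0. *)
Definition cocycleExt : Type := ({mpoly K[n]} * {mpoly K[n]})%type.
HB.instance Definition _ := GRing.Lmodule.on cocycleExt.

Definition ext_mul (a b : cocycleExt) : cocycleExt :=
  (a.1 * b.1, a.1 * b.2 + a.2 * b.1 + a.1^`M(i) * b.1^`M(j)).

Definition ext_one : cocycleExt := (1, 0).

Lemma ext_eq (a b : cocycleExt) : a.1 = b.1 -> a.2 = b.2 -> a = b.
Proof. by case: a b => [? ?] [? ?] /= -> ->. Qed.

Fact ext_mulA : associative ext_mul.
Proof.
by move=> a b c; apply: ext_eq => /=; rewrite ?mderivM; ring.
Qed.

Lemma mderiv1 k : (1 : {mpoly K[n]})^`M(k) = 0.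
Proof. exact: mderivC. Qed.

Fact ext_mul1 : left_id ext_one ext_mul.
Proof. by move=> a; apply: ext_eq => /=; rewrite ?mderiv1; ring. Qed.

Fact ext_mulr1 : right_id ext_one ext_mul.
Proof. by move=> a; apply: ext_eq => /=; rewrite ?mderiv1; ring. Qed.

Fact ext_mulDl : left_distributive ext_mul +%R.
Proof. by move=> a b c; apply: ext_eq => /=; rewrite ?mderivD; ring. Qed.

Fact ext_mulDr : right_distributive ext_mul +%R.
Proof. by move=> a b c; apply: ext_eq => /=; rewrite ?mderivD; ring. Qed.

Fact ext_one_neq0 : ext_one != 0.
Proof. by apply/eqP => /(congr1 fst)/eqP /=; rewrite oner_eq0. Qed.

HB.instance Definition _ := GRing.Zmodule_isNzRing.Build cocycleExt
  ext_mulA ext_mul1 ext_mulr1 ext_mulDl ext_mulDr ext_one_neq0.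

Fact ext_scaleAl (c : K) (a b : cocycleExt) :
  c *: (a * b) = (c *: a : cocycleExt) * b.
Proof.
by apply: ext_eq => /=; rewrite ?mderivZ -!scalerAl -?scalerDr.
Qed.
HB.instance Definition _ :=
  GRing.Lmodule_isLalgebra.Build K cocycleExt ext_scaleAl.

Fact ext_scaleAr (c : K) (a b : cocycleExt) :
  c *: (a * b) = a * (c *: b : cocycleExt).
Proof.
by apply: ext_eq => /=; rewrite ?mderivZ -!scalerAr -?scalerDr.
Qed.
HB.instance Definition _ :=
  GRing.Lalgebra_isAlgebra.Build K cocycleExt ext_scaleAr.

Lemma ext_lie (a b : cocycleExt) : lie a b =
  ((0, a.1^`M(i) * b.1^`M(j) - b.1^`M(i) * a.1^`M(j)) : cocycleExt).
Proof. by apply: ext_eq => /=; ring. Qed.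

Lemma ext_identity (a b c : cocycleExt) : lie (lie a b) c = 0.
Proof.
by rewrite !ext_lie /= !mderiv0 mul0r mulr0 subrr.
Qed.

Definition toExt : relFree K n -> cocycleExt :=
  subst (fun k => ('X_k, 0) : cocycleExt).
HB.instance Definition _ :=
  GRing.isZmodMorphism.Build (relFree K n) cocycleExt toExt
    (subst_zmod_morphism _ ext_identity).
HB.instance Definition _ :=
  GRing.isMonoidMorphism.Build (relFree K n) cocycleExt toExt
    (subst_monoid_morphism _ ext_identity).
HB.instance Definition _ :=
  GRing.isScalable.Build K (relFree K n) cocycleExt *:%R toExt
    (subst_scalable _ ext_identity).

Lemma toExt_gen k : toExt (gen K k) = ('X_k, 0).
Proof. exact: subst_gen ext_identity k. Qed.

Lemma ext_mul_snd (a : cocycleExt) (q : {mpoly K[n]}) :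
  (a * ((0, q) : cocycleExt)).2 = a.1 * q.
Proof. by rewrite /= mderiv0 !mulr0 !addr0. Qed.

Lemma mderiv_var k l : ('X_k : {mpoly K[n]})^`M(l) = (k == l)%:R.
Proof.
rewrite mderivX mnm1E; case: eqP => [->|_]; last by rewrite scale0r.
by rewrite scale1r -{1}[U_(l)%MM]add0m addmK mpolyX0.
Qed.

(** Sending the generators to (x_k, 0) makes [x_i, x_j] the element (0, 1) and
    kills the commutators of the other pairs of generators, which is what
    separates [x_i, x_j] from them. *)
Lemma toExt_lie_gen k l : toExt (lie (gen K k) (gen K l)) =
  ((0, ((k == i) && (l == j))%:R - ((l == i) && (k == j))%:R) : cocycleExt).
Proof.
rewrite rmorph_lie /= !toExt_gen ext_lie; congr (_, _).
by rewrite !mderiv_var -!natrM !mulnb.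
Qed.

End CocycleExtension.

Section Coefficient.

Variable K : fieldType.
Local Notation F3 := (relFree K 3).
Local Notation x := (@gen K 3).

(** The coefficient of [x_2, x_1], the commutator of generators 1 and 0. *)
Definition commCoef (w : F3) : {mpoly K[3]} := (toExt 1 0 w).2.

Fact commCoef_zmod_morphism : zmod_morphism commCoef.
Proof. by move=> v w; rewrite /commCoef raddfB. Qed.
HB.instance Definition _ :=
  GRing.isZmodMorphism.Build F3 {mpoly K[3]} commCoef commCoef_zmod_morphism.

Lemma toExt_ordEval (i j : 'I_3) p : (toExt i j (ordEval x p)).1 = p.
Proof.
elim/mpolyind: p => [|c m p _ _ IHp]; first by rewrite ordEval0 raddf0.
rewrite ordEvalD (raddfD (toExt i j)); congr (_ + _); last exact: IHp.
rewrite ordEvalZ /= linearZ; congr (_ *: _).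
have fstX k e : (toExt i j (x k ^+ e)).1 = 'X_k ^+ e.
  elim: e => [|e IHe]; first by rewrite !expr0 rmorph1.
  by rewrite !exprS rmorphM /= toExt_gen /= IHe.
rewrite ordEvalXm mpolyXE_id prod3E !(rmorphM (toExt i j)).
by congr (_ * _ * _); apply: fstX.
Qed.

(** The coefficient of [x_2, x_1] in the commutator of generators i and j. *)
Definition commSign (i j : 'I_3) : {mpoly K[3]} :=
  ((i == 1) && (j == 0))%:R - ((j == 1) && (i == 0))%:R.

Lemma commCoefE p i j : commCoef (ordEval x p * lie (x i) (x j)) =
  p * commSign i j.
Proof.
have toExtM : {morph toExt 1 0 : a b / a * b >-> a * b} :=
  @rmorphM _ _ (toExt 1 0).
rewrite /commCoef toExtM toExt_lie_gen ext_mul_snd.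
by congr (_ * _); apply: toExt_ordEval.
Qed.

End Coefficient.

(** * The commutator ideal as a module *)

Section CommutatorSpan.

Variables (K : fieldType) (F : algType K) (x : 'I_3 -> F).
Local Notation MP := {mpoly K[3]}.
Local Notation X1 := ('X_0 : MP).
Local Notation X2 := ('X_1 : MP).
Local Notation X3 := ('X_2 : MP).

Hypothesis F_identity : forall u v w : F, lie (lie u v) w = 0.
Hypothesis F_elim : forall P : F -> Prop, P 1 -> (forall i, P (x i)) ->
  (forall c u v, P u -> P v -> P (c *: u + v)) ->
  (forall u v, P u -> P v -> P (u * v)) -> forall u, P u.

Lemma comm_ideal_lie (u v : F) : lie u v \in comm_ideal F.
Proof. by apply: mem_ideal; exists u, v. Qed.

Lemma ordEvalM_comm (p q : MP) (w : F) : w \in comm_ideal F ->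
  ordEval x (p * q) * w = ordEval x p * (ordEval x q * w).
Proof.
exact: ordEvalM.
Qed.

Definition commComb (p q r : MP) : F :=
  ordEval x p * lie (x 1) (x 0) + ordEval x q * lie (x 2) (x 0)
  + ordEval x r * lie (x 2) (x 1).

Lemma commComb0 : commComb 0 0 0 = 0.
Proof. by rewrite /commComb ordEval0 !mul0r !addr0. Qed.

Lemma commCombD p q r p' q' r' : commComb p q r + commComb p' q' r' =
  commComb (p + p') (q + q') (r + r').
Proof.
rewrite /commComb !ordEvalD !mulrDl.
by rewrite (addrACA (_ + _)) (addrACA (ordEval x p * _)).
Qed.

Lemma commCombZ c p q r :
  c *: commComb p q r = commComb (c *: p) (c *: q) (c *: r).
Proof. by rewrite /commComb !ordEvalZ -!scalerAl -!scalerDr. Qed.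

Lemma commCombM a p q r :
  ordEval x a * commComb p q r = commComb (a * p) (a * q) (a * r).
Proof. by rewrite /commComb !ordEvalM_comm ?comm_ideal_lie // -!mulrDr. Qed.

Definition in_comb (w : F) : Prop := exists p q r, w = commComb p q r.

Lemma in_combD v w : in_comb v -> in_comb w -> in_comb (v + w).
Proof.
by move=> [p [q [r ->]]] [p' [q' [r' ->]]]; rewrite commCombD; do 3!eexists.
Qed.

Lemma in_combZ c w : in_comb w -> in_comb (c *: w).
Proof. by move=> [p [q [r ->]]]; rewrite commCombZ; do 3!eexists. Qed.

Lemma in_comb0 : in_comb 0.
Proof. by exists 0, 0, 0; rewrite commComb0. Qed.

Lemma in_combMl a w : in_comb w -> in_comb (a * w).
Proof.
elim/F_elim: a w => [|i|c u v IHu IHv|u v IHu IHv] w sw.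
- by rewrite mul1r.
- have [p [q [r ->]]] := sw.
  by rewrite -(ordEvalX x) commCombM; do 3!eexists.
- rewrite mulrDl -scalerAl.
  by apply: in_combD; [apply/in_combZ/IHu | apply: IHv].
by rewrite -mulrA; apply/IHu/IHv.
Qed.

Lemma in_comb_lie_gen i j : in_comb (lie (x i) (x j)).
Proof.
have in_comb_opp u v : in_comb (lie u v) -> in_comb (lie v u).
  by rewrite (lie_opp v) -scaleN1r; apply: in_combZ.
have s10 : in_comb (lie (x 1) (x 0)).
  by exists 1, 0, 0; rewrite /commComb ordEval0 ordEval1 !mul0r mul1r !addr0.
have s20 : in_comb (lie (x 2) (x 0)).
  exists 0, 1, 0.
  by rewrite /commComb ordEval0 ordEval1 !mul0r mul1r addr0 add0r.
have s21 : in_comb (lie (x 2) (x 1)).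
  by exists 0, 0, 1; rewrite /commComb ordEval0 ordEval1 !mul0r mul1r !add0r.
have s0 k : in_comb (lie (x k) (x k)) by rewrite lie_uu; apply: in_comb0.
by elim/ord3_ind: i; elim/ord3_ind: j => //; apply: in_comb_opp.
Qed.

(** Bracketing with a fixed element is a derivation, so its values are
    combinations as soon as its values at the generators are; this is applied to
    each of the two arguments in turn. *)
Lemma in_comb_lie u v : in_comb (lie u v).
Proof.
have derive w :
    (forall i, in_comb (lie (x i) w)) -> forall z, in_comb (lie z w).
  move=> gen_w z; elim/F_elim: z => [|//|c y z sy sz|y z sy sz].
  - by rewrite /lie mul1r mulr1 subrr; apply: in_comb0.
  - by rewrite lieDl lieZl; apply: in_combD => //; apply: in_combZ.
  rewrite lieMl (lie_central F_identity).
  by apply: in_combD; apply: in_combMl.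
apply: (derive) => i; rewrite lie_opp -scaleN1r; apply: in_combZ.
by apply: (derive) => j; apply: in_comb_lie_gen.
Qed.

Lemma comm_ideal_comb w : w \in comm_ideal F -> in_comb w.
Proof.
elim/ideal_ind => [|v z|a _ b [u [v ->]]]; [exact: in_comb0|exact: in_combD|].
rewrite -mulrA (lie_central F_identity).
by do 2!apply: in_combMl; apply: in_comb_lie.
Qed.

Lemma ordEvalB p q : ordEval x (p - q) = ordEval x p - ordEval x q.
Proof. exact: raddfB. Qed.

Lemma commComb_f010 : commComb (X2 - X1) (X3 - X1) (X3 - X2) =
  (x 1 - x 0) * lie (x 1) (x 0) + (x 2 - x 0) * lie (x 2) (x 0)
  + (x 2 - x 1) * lie (x 2) (x 1).
Proof. by rewrite /commComb !ordEvalB !ordEvalX. Qed.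

Lemma commComb_f020 :
  commComb (X2 * X2 - X1 * X1) (X3 * X3 - X1 * X1) (X3 * X3 - X2 * X2) =
  (x 1 ^+ 2 - x 0 ^+ 2) * lie (x 1) (x 0)
  + (x 2 ^+ 2 - x 0 ^+ 2) * lie (x 2) (x 0)
  + (x 2 ^+ 2 - x 1 ^+ 2) * lie (x 2) (x 1).
Proof.
rewrite /commComb !ordEvalB !mulrBl !ordEvalM_comm ?comm_ideal_lie //.
by rewrite !ordEvalX !expr2 !mulrA.
Qed.

Lemma commComb_f120 :
  commComb (X1 * (X2 * X2) - X1 * (X1 * X2)) (X1 * (X3 * X3) - X1 * (X1 * X3))
    (X2 * (X3 * X3) - X2 * (X2 * X3)) =
  (x 0 * x 1 ^+ 2 - x 0 ^+ 2 * x 1) * lie (x 1) (x 0)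
  + (x 0 * x 2 ^+ 2 - x 0 ^+ 2 * x 2) * lie (x 2) (x 0)
  + (x 1 * x 2 ^+ 2 - x 1 ^+ 2 * x 2) * lie (x 2) (x 1).
Proof.
rewrite /commComb !ordEvalB !mulrBl.
rewrite !ordEvalM_comm ?(idealMl, comm_ideal_lie) //.
by rewrite !ordEvalX !expr2 !mulrA.
Qed.

End CommutatorSpan.

(** * Symmetric elements *)

Section Symmetric.

Variable K : fieldType.
Local Notation F3 := (relFree K 3).
Local Notation x := (@gen K 3).
Local Notation MP := {mpoly K[3]}.
Local Notation X1 := ('X_0 : MP).
Local Notation X2 := ('X_1 : MP).
Local Notation X3 := ('X_2 : MP).
Local Notation commComb := (commComb x).
Local Notation F3_identity := (@relFree_identity K 3).
Local Notation F3_elim := (@relFree_elim K 3).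

Lemma F3_comb w : w \in comm_ideal F3 -> in_comb x w.
Proof. exact: comm_ideal_comb F3_identity F3_elim w. Qed.

Lemma F3combM a p q r :
  ordEval x a * commComb p q r = commComb (a * p) (a * q) (a * r).
Proof. exact: commCombM F3_identity F3_elim a p q r. Qed.

Lemma commCoef_sum3 p q r i1 j1 i2 j2 i3 j3 :
  commCoef (ordEval x p * lie (x i1) (x j1) + ordEval x q * lie (x i2) (x j2)
    + ordEval x r * lie (x i3) (x j3))
  = p * commSign K i1 j1 + q * commSign K i2 j2 + r * commSign K i3 j3.
Proof. by rewrite 2!raddfD; congr (_ + _ + _); apply: commCoefE. Qed.

Lemma commCoef_comb p q r : commCoef (commComb p q r) = p.
Proof.
by rewrite commCoef_sum3 /commSign /= !subr0 mulr1 !mulr0 !addr0.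
Qed.

Lemma permF3_term s p i j : permF3 s (ordEval x p * lie (x i) (x j)) =
  ordEval x (msym s p) * lie (x (s i)) (x (s j)).
Proof.
rewrite rmorphM rmorph_lie /= !permF3_gen.
apply: (ordEval_msym F3_identity F3_elim).
  exact: permF3_gen.
exact: comm_ideal_lie.
Qed.

Lemma permF3_comb s p q r : permF3 s (commComb p q r) =
  ordEval x (msym s p) * lie (x (s 1)) (x (s 0))
  + ordEval x (msym s q) * lie (x (s 2)) (x (s 0))
  + ordEval x (msym s r) * lie (x (s 2)) (x (s 1)).
Proof. by rewrite !(raddfD (permF3 s)) /= !permF3_term. Qed.

Lemma commCoef_permF3_12 p q r :
  commCoef (permF3 (tperm 0 1) (commComb p q r)) = - msym (tperm 0 1) p.
Proof.
rewrite permF3_comb tpermL tpermR tpermD //.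
by rewrite commCoef_sum3 /commSign /= !subr0 !sub0r !mulr0 !addr0 mulrN1.
Qed.

Lemma commCoef_permF3_23 p q r :
  commCoef (permF3 (tperm 1 2) (commComb p q r)) = msym (tperm 1 2) q.
Proof.
rewrite permF3_comb tpermL tpermR tpermD //.
by rewrite commCoef_sum3 /commSign /= !subr0 !mulr0 mulr1 addr0 add0r.
Qed.

Lemma commCoef_permF3_13 p q r :
  commCoef (permF3 (tperm 0 2) (commComb p q r)) = - msym (tperm 0 2) r.
Proof.
rewrite permF3_comb tpermL tpermR tpermD //.
by rewrite commCoef_sum3 /commSign /= !subr0 !sub0r !mulr0 !add0r mulrN1.
Qed.

Lemma msym_eq0 s (p : MP) : msym s p = 0 -> p = 0.
Proof. by move=> p0; apply: (@inj_msym _ _ s); rewrite p0 msym0. Qed.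

(** The transposition of x_2 and x_3 carries [x_3, x_1] to [x_2, x_1], and that
    of x_1 and x_3 carries [x_3, x_2] to [x_1, x_2]; so in a symmetric element
    the coefficients q and r are, up to sign, permuted copies of p. *)
Lemma sym_commCoef_eq0 w : w \in comm_ideal F3 ->
  (forall s, permF3 s w = w) -> commCoef w = 0 -> w = 0.
Proof.
move=> /F3_comb[p [q [r ->]]] sym_w; rewrite commCoef_comb => p0.
have q0 : q = 0.
  apply: (@msym_eq0 (tperm 1 2)).
  by rewrite -(commCoef_permF3_23 p q r) sym_w commCoef_comb.
have r0 : r = 0.
  apply: (@msym_eq0 (tperm 0 2)); apply/eqP; rewrite -oppr_eq0; apply/eqP.
  by rewrite -(commCoef_permF3_13 p q r) sym_w commCoef_comb.
by rewrite p0 q0 r0 commComb0.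
Qed.

Lemma commCoefM c w : w \in comm_ideal F3 ->
  commCoef (ordEval x c * w) = c * commCoef w.
Proof.
move=> /F3_comb[p [q [r ->]]]; apply: etrans (congr1 _ (F3combM c p q r)) _.
apply: etrans (commCoef_comb _ _ _) _; congr (_ * _).
exact/esym/commCoef_comb.
Qed.

Definition symCoef (w : symF3' K) : MP := commCoef (val (val w)).

Fact symCoef_zmod_morphism : zmod_morphism symCoef.
Proof. by move=> v w; rewrite /symCoef !raddfB. Qed.
HB.instance Definition _ :=
  GRing.isZmodMorphism.Build (symF3' K) MP symCoef symCoef_zmod_morphism.

Lemma symCoefZ (c : symPoly K) w : symCoef (c *: w) = val c * symCoef w.
Proof. exact/commCoefM/commElt_subproof. Qed.

Lemma symCoef_fixed (w : symF3' K) s : permF3 s (val (val w)) = val (val w).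
Proof. by have /forallP/(_ s)/eqP := symElt_subproof w. Qed.

Lemma symCoef_inj : injective symCoef.
Proof.
move=> v w /eqP; rewrite -subr_eq0 -raddfB => /eqP Evw; apply/eqP.
rewrite -subr_eq0; apply/eqP; do 2!apply: val_inj.
apply: sym_commCoef_eq0 Evw; first exact: commElt_subproof.
exact: symCoef_fixed.
Qed.

Lemma symCoef_antisym w : msym (tperm 0 1) (symCoef w) = - symCoef w.
Proof.
have /F3_comb[p [q [r Ew]]] := commElt_subproof (val w).
have coef_w : symCoef w = p.
  exact: etrans (congr1 _ Ew) (commCoef_comb p q r).
rewrite coef_w; apply: oppr_inj; rewrite opprK -[RHS]coef_w.
apply: etrans (esym (commCoef_permF3_12 p q r)) _; rewrite -Ew.
exact: congr1 (symCoef_fixed w (tperm 0 1)).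
Qed.

Lemma symCoef_f010 : symCoef (f010 K) = X2 - X1.
Proof.
apply: etrans (commCoef_comb (X2 - X1) (X3 - X1) (X3 - X2)).
apply: (congr1 (@commCoef K)); exact: esym (commComb_f010 x).
Qed.

Lemma symCoef_f020 : symCoef (f020 K) = (X1 + X2) * (X2 - X1).
Proof.
have -> : (X1 + X2) * (X2 - X1) = X2 * X2 - X1 * X1 by ring.
apply: etrans (commCoef_comb _ (X3 * X3 - X1 * X1) (X3 * X3 - X2 * X2)).
apply: (congr1 (@commCoef K)); exact: esym (commComb_f020 F3_identity F3_elim).
Qed.

Lemma symCoef_f120 : symCoef (f120 K) = X1 * X2 * (X2 - X1).
Proof.
have -> : X1 * X2 * (X2 - X1) = X1 * (X2 * X2) - X1 * (X1 * X2) by ring.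
apply: etrans (commCoef_comb _ (X1 * (X3 * X3) - X1 * (X1 * X3))
  (X2 * (X3 * X3) - X2 * (X2 * X3))).
apply: (congr1 (@commCoef K)); exact: esym (commComb_f120 F3_identity F3_elim).
Qed.

(** The three generators have coefficients x_2 - x_1 times 1, x_1 + x_2 and
    x_1 x_2, so combining them amounts to combining these factors. *)
Lemma symCoef_sum (c : 'I_3 -> symPoly K) :
  symCoef (\sum_i c i *: tnth [tuple f010 K; f020 K; f120 K] i)
  = (val (c 0) + val (c 1) * (X1 + X2) + val (c 2) * (X1 * X2)) * (X2 - X1).
Proof.
rewrite sum3E !(raddfD symCoef) /= !symCoefZ !(tnth_nth 0) /=.
rewrite symCoef_f010 symCoef_f020 symCoef_f120; ring.
Qed.

End Symmetric.

Theorem theorem3p6 (K : fieldType) (charK0 : [pchar K] =i pred0) :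
  minimal_generating_set
    (fun w : symF3' K => w \in [:: f010 K; f020 K; f120 K]) /\
  freely_generated_by [tuple f010 K; f020 K; f120 K].
Proof.
suff free_f : freely_generated_by [tuple f010 K; f020 K; f120 K].
  by split=> //; apply: (freely_generated_minimal free_f).
have nz2 : (2 : K) != 0 by rewrite (iffLR (pcharf0P K) charK0).
have nzX : ('X_1 - 'X_0 : {mpoly K[3]}) != 0 by apply: mpolyX_neq.
move=> w; have [b [c [cs def_b]] Ew] :=
  antisymmetric_pair_span nz2 (symCoef_antisym w).
pose d := [ffun i => SymPoly (cs i)].
have def_w : w = \sum_i d i *: tnth [tuple f010 K; f020 K; f120 K] i.
  by apply: symCoef_inj; rewrite symCoef_sum Ew def_b !ffunE.
exists d; split=> // e def_w'; apply/ffunP => i; apply/val_inj.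
have [] := @pair_basis_free K (val (d 0) - val (e 0)) (val (d 1) - val (e 1))
  (val (d 2) - val (e 2)).
- exact: rpredB (valP (d 0)) (valP (e 0)).
- exact: rpredB (valP (d 1)) (valP (e 1)).
- exact: rpredB (valP (d 2)) (valP (e 2)).
- apply: (mulIf nzX); rewrite mul0r; transitivity (symCoef w - symCoef w).
    by rewrite {1}def_w def_w' !symCoef_sum; ring.
  exact: subrr.
move=> /subr0_eq E0 /subr0_eq E1 /subr0_eq E2.
by elim/ord3_ind: i.
Qed.
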